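(* The set $X$ of characters of the (additive group of the) field $F^{(s)}$, with multiplication of characters $(\chi\psi)(a)=\chi(a)\psi(a)$ as the interior operation and powering $(\chi,\mathbf b)\mapsto\chi^{\mathbf b}$, $\mathbf b\in GF(p^s)$, as the exterior operation, is a vector space over the finite field $GF(p^s)$.
   Context: $p$ is a prime, $s\in\mathbb N$. $GF(p^s)$ is the finite field of $p^s$ elements, realized as vectors $\mathbf a=(a^{(0)},\dots,a^{(s-1)})$ with $a^{(l)}\in GF(p)=\{0,\dots,p-1\}$; addition is coordinatewise mod $p$, multiplication is multiplication of the polynomials $\sum_l a^{(l)}t^l$ over $GF(p)$ modulo a fixed irreducible polynomial of degree $s$; the unit is $(1,0,\dots,0)$. $F^{(s)}$ is the local field of characteristic $p$ consisting of sequences $a=(\mathbf a_j)_{j\in\mathbb Z}$, $\mathbf a_j\in GF(p^s)$, with only finitely many nonzero $\mathbf a_j$ with $j<0$; addition is coordinatewise, multiplication is convolution, and the subgroups $F^{(s)}_n=\{a:\mathbf a_j=\mathbf 0\ \forall j<n\}$ form a neighbourhood basis of zero. Characters are continuous characters of the additive group. For $k\in\mathbb Z$, $\mathbf u\in GF(p^s)$, $\mathbf r_k^{\mathbf u}\in X$ is $\mathbf r_k^{\mathbf u}(x)=\prod_{l=0}^{s-1}\exp\left(\frac{2\pi i}{p}u^{(l)}x_k^{(l)}\right)$, where $x=(\mathbf x_k)$, $\mathbf x_k=(x_k^{(0)},\dots,x_k^{(s-1)})$. Every $\chi\in X$ can be written uniquely as $\chi=\prod_{k\in\mathbb Z}\mathbf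 r_k^{\mathbf a_k}$ with $\mathbf a_k\in GF(p^s)$ and only finitely many $\mathbf a_k\ne\mathbf 0$ with $k>0$. By definition $(\mathbf r_k^{\mathbf a_k})^{\mathbf b}:=\mathbf r_k^{\mathbf a_k\mathbf b}$ (product in $GF(p^s)$), and $\chi^{\mathbf b}:=\prod_{k\in\mathbb Z}\mathbf r_k^{\mathbf a_k\mathbf b}$ for $\mathbf b\in GF(p^s)$. *)

(* Defs.v *)
From HB Require Import structures.
From mathcomp Require Import all_boot all_order all_algebra.
From mathcomp Require Import all_classical all_reals all_analysis.
From mathcomp Require Import complex.

Set Implicit Arguments.
Unset Strict Implicit.
Unset Printing Implicit Defensive.

Import Order.TTheory GRing.Theory Num.Theory.
Import numFieldNormedType.Exports.

Local Open Scope classical_set_scope.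
Local Open Scope ring_scope.
Local Open Scope complex_scope.

Definition is_vector_space (K : fieldType) (X : Type)
    (add : X -> X -> X) (scale : K -> X -> X) : Prop :=
  exists c : GRing.Lmodule K X, let V : lmodType K := GRing.Lmodule.Pack c in
    (forall u v : V, u + v = add u v) /\
    (forall (b : K) (v : V), b *: v = scale b v).

Section FiniteField.
Variables (p s : nat) (f : {poly 'F_p}).

Definition GF (f_irr : irreducible_poly f) (f_deg : size f = s.+1) : Type :=
  'rV['F_p]_s.

Hypotheses (f_irr : irreducible_poly f) (f_deg : size f = s.+1).
Local Notation K := (GF f_irr f_deg).

HB.instance Definition _ := GRing.Zmodule.on K.

Definition GF_coord (a : K) (l : 'I_s) : 'F_p := (a : 'rV_s) 0 l.

(* A vector is read as a polynomial in t, lowest degree first. *)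
Definition GF_poly (a : K) : {poly 'F_p} := rVpoly a.
Definition GF_of_poly (q : {poly 'F_p}) : K := poly_rV (q %% f).

Definition GF_one : K := GF_of_poly 1.
Definition GF_mul (a b : K) : K := GF_of_poly (GF_poly a * GF_poly b).

Definition GF_inv (a : K) : K := xget 0 [set b : K | GF_mul b a = GF_one].

Let f_neq0 : f != 0. Proof. by rewrite -size_poly_gt0 f_deg. Qed.

Lemma GF_polyE q : GF_poly (GF_of_poly q) = q %% f.
Proof. by rewrite /GF_poly poly_rV_K// -ltnS -f_deg ltn_modp. Qed.

Lemma GF_poly_inj : injective GF_poly.
Proof. by move=> a b /(congr1 (@poly_rV _ s)); rewrite !rVpolyK. Qed.

Lemma GF_poly_mod a : GF_poly a %% f = GF_poly a.
Proof. by rewrite modp_small// f_deg ltnS size_poly. Qed.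

Lemma GF_poly1 : GF_poly GF_one = 1.
Proof. by rewrite GF_polyE modp_small// size_poly1; case: f_irr. Qed.

Lemma GF_polyD a b : GF_poly (a + b) = GF_poly a + GF_poly b.
Proof. exact: raddfD. Qed.

Let mulA : associative GF_mul.
Proof.
move=> a b c; apply: GF_poly_inj; rewrite !GF_polyE.
by rewrite modp_mul [in RHS]mulrC modp_mul [in RHS]mulrC mulrA.
Qed.

Let mulC : commutative GF_mul.
Proof. by move=> a b; apply: GF_poly_inj; rewrite !GF_polyE mulrC. Qed.

Let mul1 : left_id GF_one GF_mul.
Proof.
by move=> a; apply: GF_poly_inj; rewrite GF_polyE GF_poly1 mul1r GF_poly_mod.
Qed.

Let mulD : left_distributive GF_mul +%R.
Proof.
move=> a b c; apply: GF_poly_inj.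
by rewrite GF_polyD !GF_polyE GF_polyD mulrDl modpD.
Qed.

Let one_neq0 : GF_one != 0.
Proof.
apply/eqP => /(congr1 GF_poly); rewrite GF_poly1 /GF_poly raddf0 => /eqP.
by rewrite oner_eq0.
Qed.

HB.instance Definition _ :=
  GRing.Zmodule_isComNzRing.Build K mulA mulC mul1 mulD one_neq0.

Let mulV (a : K) : a != 0 -> GF_inv a * a = 1.
Proof.
move=> a_neq0; suff [b ba1] : exists b : K, GF_mul b a = GF_one.
  exact: (@xgetPex _ 0 [set b : K | GF_mul b a = GF_one] (ex_intro _ b ba1)).
have pa_neq0 : GF_poly a != 0.
  apply: contra_neq a_neq0 => pa0; apply: GF_poly_inj.
  by rewrite pa0 /GF_poly raddf0.
have cop : coprimep (GF_poly a) f.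
  rewrite /coprimep; apply: contraT => g1.
  have /(eqp_dvdl (GF_poly a)) := f_irr.2 _ g1 (dvdp_gcdr _ _).
  rewrite dvdp_gcdl => /esym/(dvdp_leq pa_neq0).
  by rewrite f_deg leqNgt ltnS size_poly.
have [[u v] /= uv1] := Bezout_eq1_coprimepP _ _ cop.
exists (GF_of_poly u); apply: GF_poly_inj; rewrite !GF_polyE -uv1.
by rewrite mulrC modp_mul modpD modp_mull addr0 mulrC.
Qed.

Let inv0 : GF_inv 0 = 0.
Proof.
rewrite /GF_inv; apply: xgetPN => b /=.
rewrite -[GF_mul _ _]/(b * 0 : K) mulr0 => /esym/eqP.
by rewrite (negPf one_neq0).
Qed.

HB.instance Definition _ := GRing.ComNzRing_isField.Build K mulV inv0.

Lemma GF_coord0 l : GF_coord (0 : K) l = 0.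
Proof. exact: mxE. Qed.

Lemma GF_coordD (a b : K) l : GF_coord (a + b) l = GF_coord a l + GF_coord b l.
Proof. exact: mxE. Qed.

End FiniteField.

Section LocalField.
Variables (p s : nat) (f : {poly 'F_p}).
Variables (f_irr : irreducible_poly f) (f_deg : size f = s.+1).
Local Notation K := (GF f_irr f_deg).

Definition finite_negative_support : {pred int -> K} :=
  fun a => `[< finite_set [set j : int | j < 0 /\ a j != 0] >].

(* The additive group of the local field; the convolution product plays no role
   for characters and is left out. *)
Record local_field : Type := LocalField {
  lf_seq :> int -> K;
  _ : lf_seq \in finite_negative_support }.

HB.instance Definition _ := [isSub for lf_seq].
HB.instance Definition _ := [Choice of local_field by <:].

Let fnsP a : reflect (finite_set [set j : int | j < 0 /\ a j != 0])
  (a \in finite_negative_support).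
Proof. exact: asboolP. Qed.

Let fns_zmod_closed : zmod_closed finite_negative_support.
Proof.
split=> [|a b].
  apply/fnsP; apply: (sub_finite_set _ (@finite_set0 int)) => j /= [].
  by rewrite eqxx.
move=> /fnsP fa /fnsP fb; apply/fnsP.
have : finite_set ([set j : int | j < 0 /\ a j != 0] `|`
                   [set j : int | j < 0 /\ b j != 0]) by rewrite finite_setU.
apply: sub_finite_set => j /= [j0 abj].
have [aj0|aj] := eqVneq (a j) 0; [right|by left].
by split=> //; apply: contra_neq abj => bj0; rewrite !fctE aj0 bj0 subr0.
Qed.

HB.instance Definition _ :=
  GRing.isZmodClosed.Build _ finite_negative_support fns_zmod_closed.
HB.instance Definition _ := [SubChoice_isSubZmodule of local_field by <:].

Definition lf_subgroup (n : int) : set local_field :=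
  [set a | forall j, j < n -> a j = 0].

Definition lf_nbhs (x : local_field) : set_system local_field :=
  filter_from setT (fun n : int => [set y | lf_subgroup n (y - x)]).

HB.instance Definition _ := hasNbhs.Build local_field lf_nbhs.

Lemma lfD (x y : local_field) j : (x + y) j = x j + y j.
Proof. by []. Qed.

Lemma lfB (x y : local_field) j : (x - y) j = x j - y j.
Proof. by []. Qed.

Lemma lf_subgroup_subE n (x y : local_field) :
  lf_subgroup n (y - x) <-> forall j, j < n -> y j = x j.
Proof.
split=> yx j /yx; rewrite lfB; last by move=> ->; rewrite subrr.
by move=> /eqP; rewrite subr_eq0 => /eqP.
Qed.

Let lf_nbhs_filter (x : local_field) : ProperFilter (nbhs x).
Proof.
apply: filter_from_proper; first apply: filter_from_filter.
- by exists 0.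
- move=> m n _ _; exists (Order.max m n) => // y /= /lf_subgroup_subE yx.
  by split; apply/lf_subgroup_subE => j jlt; apply: yx; rewrite lt_max jlt ?orbT.
- by move=> n _; exists x; apply/lf_subgroup_subE.
Qed.

Let lf_nbhs_singleton (x : local_field) (A : set local_field) : nbhs x A -> A x.
Proof. by move=> [n _ sub]; apply: sub; apply/lf_subgroup_subE. Qed.

Let lf_nbhs_nbhs (x : local_field) (A : set local_field) :
  nbhs x A -> nbhs x (nbhs^~ A).
Proof.
move=> [n _ sub]; exists n => // y /lf_subgroup_subE yx.
exists n => // z /lf_subgroup_subE zy.
by apply: sub; apply/lf_subgroup_subE => j jn; rewrite zy// yx.
Qed.

HB.instance Definition _ := Nbhs_isNbhsTopological.Build local_field
  lf_nbhs_filter lf_nbhs_singleton lf_nbhs_nbhs.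

End LocalField.

Section Characters.
Variables (R : realType) (p s : nat) (p_prime : prime p) (f : {poly 'F_p}).
Variables (f_irr : irreducible_poly f) (f_deg : size f = s.+1).
Local Notation K := (GF f_irr f_deg).
Local Notation F := (local_field f_irr f_deg).

Record character : Type := Character {
  char_fun :> F -> R[i];
  char_unit : forall x, `|char_fun x| = 1;
  charD : forall x y, char_fun (x + y) = char_fun x * char_fun y;
  char_continuous : continuous (char_fun : F -> R[i]^o) }.

Arguments char_unit : clear implicits.
Arguments charD : clear implicits.
Arguments char_continuous : clear implicits.

Lemma char_eq (chi psi : character) : (forall x, chi x = psi x) -> chi = psi.
Proof.
case: chi psi => [u u1 uD uc] [v v1 vD vc] /= /funext uv; subst v.
by congr Character; apply: Prop_irrelevance.
Qed.

Let mul_unit (chi psi : character) x : `|chi x * psi x| = 1.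
Proof. by rewrite normrM !char_unit mulr1. Qed.

Let mulDl (chi psi : character) x y :
  chi (x + y) * psi (x + y) = (chi x * psi x) * (chi y * psi y).
Proof. by rewrite !charD mulrACA. Qed.

Let mul_continuous (chi psi : character) :
  continuous ((fun x => chi x * psi x) : F -> R[i]^o).
Proof.
move=> x; apply: (@cvgM (R[i] : numFieldType) F (nbhs x) _ chi psi).
  exact: (char_continuous chi x).
exact: (char_continuous psi x).
Qed.

Definition char_mul (chi psi : character) : character :=
  Character (mul_unit chi psi) (mulDl chi psi) (@mul_continuous chi psi).

Definition expi (t : R) : R[i] := cos t +i* sin t.

Definition rademacher (k : int) (u : K) (x : F) : R[i] :=
  \prod_(l < s) expi (2 * pi / p%:R * (GF_coord u l * GF_coord (x k) l)%N%:R).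

Definition finite_positive_support : {pred int -> K} :=
  fun a => `[< finite_set [set k : int | 0 < k /\ a k != 0] >].

(* The sequences [a] for which the infinite product of the [rademacher k (a k)]
   is a character. *)
Record dual_seq : Type := DualSeq {
  ds_seq :> int -> K;
  _ : ds_seq \in finite_positive_support }.

HB.instance Definition _ := [isSub for ds_seq].
HB.instance Definition _ := [Choice of dual_seq by <:].

Let fpsP a : reflect (finite_set [set k : int | 0 < k /\ a k != 0])
  (a \in finite_positive_support).
Proof. exact: asboolP. Qed.

Let ds_zero_subproof : (fun=> 0 : K) \in finite_positive_support.
Proof.
apply/fpsP; apply: (sub_finite_set _ (@finite_set0 int)) => j /= [].
by rewrite eqxx.
Qed.

Definition ds_zero : dual_seq := DualSeq ds_zero_subproof.

Let ds_mulr_subproof (a : dual_seq) (b : K) :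
  (fun k => a k * b) \in finite_positive_support.
Proof.
case: a => a /= /fpsP fa; apply/fpsP; apply: sub_finite_set fa => k /= [k0 abk].
by split=> //; apply: contra_neq abk => ->; rewrite mul0r.
Qed.

Definition ds_mulr (a : dual_seq) (b : K) : dual_seq :=
  DualSeq (ds_mulr_subproof a b).

(* For each [x] only finitely many factors differ from 1, see
   [rademacher_finite_support]. *)
Definition rademacher_prod (a : dual_seq) (x : F) : R[i] :=
  \big[*%R/1]_(k \in [set: int]) rademacher k (a k) x.

Lemma expi0 : expi 0 = 1. Proof. by rewrite /expi cos0 sin0. Qed.

Lemma expiD a b : expi (a + b) = expi a * expi b.
Proof.
rewrite /expi cosD sinD; apply/eqP.
by rewrite eq_complex/= eqxx/= addrC [X in _ + X]mulrC eqxx.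
Qed.

Lemma norm_expi t : `|expi t| = 1.
Proof. by rewrite /expi normc_def /= cos2Dsin2 sqrtr1. Qed.

Let root n : R[i] := expi (2 * pi / p%:R * n%:R).

Let rootD m n : root (m + n) = root m * root n.
Proof. by rewrite /root natrD mulrDr expiD. Qed.

Let root_mulp n : root (n * p) = 1.
Proof.
elim: n => [|n IHn]; first by rewrite /root mul0n mulr0 expi0.
rewrite mulSn rootD IHn mulr1 /root mulfVK; last first.
  by rewrite pnatr_eq0 -lt0n prime_gt0.
rewrite mulr_natl mulr2n expiD /expi cospi sinpi; apply/eqP.
by rewrite eq_complex/= mulrNN !mulr0 mul0r mul1r subr0 addr0 !eqxx.
Qed.

Let root_mod n : root (n %% p) = root n.
Proof. by rewrite [in RHS](divn_eq n p) rootD root_mulp mul1r. Qed.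

Lemma rademacher0 k (x : F) : rademacher k 0 x = 1.
Proof. by apply: big1 => l _; rewrite GF_coord0 mul0n mulr0 expi0. Qed.

Lemma rademacher_at0 k u (x : F) : x k = 0 -> rademacher k u x = 1.
Proof.
by move=> xk0; apply: big1 => l _; rewrite xk0 GF_coord0 muln0 mulr0 expi0.
Qed.

Lemma rademacherD k u (x y : F) :
  rademacher k u (x + y) = rademacher k u x * rademacher k u y.
Proof.
rewrite -big_split; apply: eq_bigr => l _.
rewrite -[LHS]/(root _) -[RHS]/(root _ * root _) -rootD -mulnDr.
rewrite [(x + y) k]lfD GF_coordD -[LHS]root_mod -[RHS]root_mod.
congr root; rewrite -[in RHS]modnMmr; congr (_ * _ %% _)%N.
by congr (_ %% _)%N; exact: Fp_cast.
Qed.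

Lemma norm_rademacher k u (x : F) : `|rademacher k u x| = 1.
Proof. by rewrite normr_prod big1// => l _; exact: norm_expi. Qed.

Lemma rademacher_finite_support (a : dual_seq) (x : F) :
  finite_set [set k | rademacher k (a k) x != 1].
Proof.
have /asboolP fx := valP x; have /asboolP fa := valP a.
have : finite_set ([set k : int | k < 0 /\ x k != 0] `|`
                   [set k : int | 0 < k /\ a k != 0] `|` [set 0]).
  by rewrite !finite_setU.
apply: sub_finite_set => k /= rk1.
have xk : x k != 0 by apply: contra_neq rk1; exact: rademacher_at0.
have ak : a k != 0 by apply: contra_neq rk1 => ->; exact: rademacher0.
by have [k0|k0|->] := ltgtP k 0; [left; left|left; right|right].
Qed.

Lemma rademacher_prodE (a : dual_seq) (x : F) (P : set int) :
    [set k | rademacher k (a k) x != 1] `<=` P ->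
  rademacher_prod a x = \big[*%R/1]_(k \in P) rademacher k (a k) x.
Proof.
move=> suppP; apply/esym/fsbig_widen => // k [_ Pk] /=.
by apply: contrapT => rk1; apply/Pk/suppP/eqP.
Qed.

Let prod_unit a (x : F) : `|rademacher_prod a x| = 1.
Proof.
have fs := rademacher_finite_support a x.
rewrite (rademacher_prodE (@subset_refl _ _)) fsbig_finite// normr_prod big1// => k _.
exact: norm_rademacher.
Qed.

Let prodD a (x y : F) :
  rademacher_prod a (x + y) = rademacher_prod a x * rademacher_prod a y.
Proof.
set P := [set k | rademacher k (a k) x != 1] `|`
         [set k | rademacher k (a k) y != 1].
have fP : finite_set P.
  by rewrite finite_setU; split; apply: rademacher_finite_support.
have xP : [set k | rademacher k (a k) x != 1] `<=` P by move=> k; left.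
have yP : [set k | rademacher k (a k) y != 1] `<=` P by move=> k; right.
have xyP : [set k | rademacher k (a k) (x + y) != 1] `<=` P.
  move=> k /=; rewrite rademacherD => xy1.
  have [x1|x1] := eqVneq (rademacher k (a k) x) 1; [right|by left].
  by apply: contra_neq xy1 => y1; rewrite x1 y1 mulr1.
rewrite (rademacher_prodE xP) (rademacher_prodE yP) (rademacher_prodE xyP) -fsbig_split//.
by apply: eq_fsbigr => k _; exact: rademacherD.
Qed.

Let prod_continuous a : continuous (rademacher_prod a : F -> R[i]^o).
Proof.
have [n an0] : exists n : int, forall k, n <= k -> a k = 0.
  have /asboolP/finite_seqP[r rE] := valP a.
  have [n nr] : exists n : int, 0 < n /\ forall k, k \in r -> k < n.
    elim: {rE} r => [|m r [n [n0 nr]]]; first by exists 1.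
    exists (Order.max n (m + 1)); split=> [|k]; first by rewrite lt_max n0.
    by rewrite inE lt_max => /orP[/eqP->|/nr ->//]; rewrite ltrDl ltr01 orbT.
  exists n => k nk; apply: contrapT => /eqP ak; have : [set` r] k.
    by rewrite -rE; split=> //; apply: lt_le_trans nk; case: nr.
  by move=> /= /(nr.2); rewrite ltNge nk.
move=> x A /nbhs_singleton Ax; exists n => // y /= /lf_subgroup_subE yx.
suff -> : rademacher_prod a y = rademacher_prod a x by [].
apply: eq_fsbigr => k _; have [nk|kn] := leP n k.
  by rewrite an0// !rademacher0.
by rewrite /rademacher yx.
Qed.

Definition char_of (a : dual_seq) : character :=
  Character (prod_unit a) (prodD a) (@prod_continuous a).

(* Every character is [char_of a] for exactly one [a], so that the default
   value is never used. *)
Definition char_coords (chi : character) : dual_seq :=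
  xget ds_zero [set a | chi = char_of a].

Definition char_pow (chi : character) (b : K) : character :=
  char_of (ds_mulr (char_coords chi) b).

End Characters.

(* Main.v *)
From HB Require Import structures.
Require Import Defs.
From mathcomp Require Import all_boot all_order all_algebra.
From mathcomp Require Import all_classical all_reals all_analysis.
From mathcomp Require Import complex ring.

Set Implicit Arguments.
Unset Strict Implicit.
Unset Printing Implicit Defensive.

Import Order.TTheory GRing.Theory Num.Theory.
Import numFieldNormedType.Exports.
Local Open Scope ring_scope.

(** The coordinates of a character identify the group of characters with a
    set of sequences over GF(p^s).  Under this identification the product of
    characters becomes the coordinatewise sum ([char_coords_mul]) and powering
    by b becomes the coordinatewise product with b ([char_coords_pow]).  As a
    character is determined by its coordinates, every vector space axiom is an
    instance of a field axiom in GF(p^s).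

    What has to be proved is that the coordinates exist and are unique.  Let
    e_{k,l} be the element of the local field whose only nonzero term is the
    l-th basis vector of GF(p^s), at place k, and let zeta = exp(2 pi i / p).

    - The local field has characteristic p, so a character takes only p-th
      roots of unity as values.  The powers of a root of unity other than 1
      sum to 0, hence cannot all be at distance less than 1 from 1
      ([root_of_unity_near1]).  A continuous character is therefore trivial,
      and not merely close to 1, on some F_n ([char_trivial]).
    - Modulo F_n every element of the local field is a finite sum of multiples
      of the e_{k,l}.  Hence the values at these elements determine a character
      ([char_eq_units]).
    - The value at e_{k,l} of the product of generalized Rademacher characters
      with exponents a_k is zeta to the power a_k^(l) ([char_of_unit]).  As zeta
      is a primitive p-th root of unity, these values determine a.  For the same
      reason the value of any character at e_{k,l} is such a power, and its
      exponents vanish for k >= n: every character arises from a sequence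
      ([char_of_surj]). *)

(** * Vector spaces and roots of unity *)

(** The structure of a left module over a type also records a decidable
    equality and a choice operator; for an arbitrary type both come from
    classical logic. *)
Lemma is_vector_space_axioms (K : fieldType) (X : Type)
    (add : X -> X -> X) (zero : X) (opp : X -> X) (scale : K -> X -> X) :
    associative add -> commutative add -> left_id zero add ->
    left_inverse zero opp add ->
    (forall a b v, scale a (scale b v) = scale (a * b) v) ->
    left_id 1 scale -> right_distributive scale add ->
    (forall v a b, scale (a + b) v = add (scale a v) (scale b v)) ->
  is_vector_space add scale.
Proof.
move=> addA addC add0 addN scaleA scale1 scaleDr scaleDl.
pose Xc : choiceType := HB.pack X (gen_eqMixin X) (gen_choiceMixin X).
pose Xz : zmodType := HB.pack X (Choice.class Xc)
  (@GRing.isZmodule.Build Xc zero opp add addA addC add0 addN).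
pose V : lmodType K := HB.pack X (GRing.Zmodule.class Xz)
  (@GRing.Zmodule_isLmodule.Build K Xz scale scaleA scale1 scaleDr scaleDl).
by exists (GRing.Lmodule.class V).
Qed.

Section RootOfUnity.
Variable R : realType.

Lemma expiM (t : R) n : expi (t * n%:R) = expi t ^+ n.
Proof.
elim: n => [|n IHn]; first by rewrite mulr0 expi0 expr0.
by rewrite exprS -IHn -expiD -natr1 mulrDr mulr1 addrC.
Qed.

(** If 1 < p the half angle pi / p lies in ]0, pi[, where the sine is positive;
    and cos (2 t) = 1 - 2 sin^2 t. *)
Lemma expi_neq1 p : (1 < p)%N -> expi (2 * pi / p%:R : R) != 1.
Proof.
move=> p1; have p0 : 0 < p%:R :> R by rewrite ltr0n ltnW.
have sin_gt0 : 0 < sin (pi / p%:R : R).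
  apply: sin_gt0_pi; rewrite divr_gt0 ?pi_gt0//=.
  by rewrite ltr_pdivrMr// ltr_pMr ?ltr1n// pi_gt0.
rewrite /expi -mulrA mulr_natl cos_mulr2n eq_complex /= negb_and.
apply/orP; left.
rewrite cos2sin2 (_ : _ - 1 = 1 - sin (pi / p%:R) ^+ 2 *+ 2); last by ring.
rewrite -subr_eq0 addrAC subrr add0r.
by rewrite oppr_eq0 mulrn_eq0/= expf_neq0 // gt_eqF.
Qed.

Lemma expi_primitive p : prime p ->
  p.-primitive_root (expi (2 * pi / p%:R : R)).
Proof.
move=> p_prime; have p0 := prime_gt0 p_prime.
have zp1 : expi (2 * pi / p%:R : R) ^+ p = 1.
  rewrite -expiM mulfVK ?pnatr_eq0 -?lt0n //.
  by rewrite mulr_natl /expi cos2pi sin2pi.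
have [m prim_m] := prim_order_exists p0 zp1.
case/primeP: (p_prime) => p1 /[apply] /orP[] /eqP mE;
  last by move: prim_m; rewrite mE.
have := prim_expr_order prim_m; rewrite mE expr1 => /eqP.
by rewrite (negPf (expi_neq1 p1)).
Qed.

(** The identity 1 + w + ... + w^(p-1) = 0, which holds if w is not 1, says that
    the p differences w^j - 1 add up to -p; but each has norm less than 1.  So
    the open disc of radius 1 around 1 contains no nontrivial finite cyclic
    group. *)
Lemma root_of_unity_near1 (C : numDomainType) (w : C) p : (0 < p)%N ->
  w ^+ p = 1 -> (forall j, `|w ^+ j - 1| < 1) -> w = 1.
Proof.
move=> p0 wp1 wnear; apply/eqP; rewrite -subr_eq0; apply: contraT => w1.
have /esym/eqP := subrX1 w p; rewrite wp1 subrr mulf_eq0 (negPf w1) /= => /eqP s0.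
have sE : \sum_(j < p) (w ^+ j - 1) = - p%:R.
  by rewrite sumrB s0 sumr_const card_ord sub0r.
have : `|\sum_(j < p) (w ^+ j - 1)| < p%:R.
  apply: le_lt_trans (ler_norm_sum _ _ _) _.
  (* Strictness of the sum of strict inequalities needs a nonempty range. *)
  have -> : p%:R = \sum_(j < p) (1 : C) by rewrite sumr_const card_ord.
  apply: ltr_sum => [|j _]; last exact: wnear.
  by apply/hasP; exists (Ordinal p0) => //; rewrite mem_index_enum.
by rewrite sE normrN normr_nat ltxx.
Qed.

End RootOfUnity.

Lemma finite_int_bounded (A : set int) : finite_set A ->
  exists n : nat, forall k, A k -> (`|k| <= n)%N.
Proof.
move=> /finite_seqP[r ->]; exists (\max_(k <- r) `|k|%N)%N => k /= kr.
exact: (@leq_bigmax_seq _ r xpredT (fun k : int => `|k|%N)).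
Qed.

Lemma finite_int_below (A : set int) (n : int) :
  (forall k, A k -> 0 <= k < n) -> finite_set A.
Proof.
move=> An; apply: (@sub_finite_set _ _ (Posz @` `I_`|n|%N)%classic).
  move=> k /An; case: k => k //= kn; exists k => //=.
  by case: n kn {An} => n //.
by apply: finite_image; exact: finite_II.
Qed.

(** * Additive generators of the local field *)

Section LocalFieldGenerators.
Variables (p s : nat) (p_prime : prime p) (f : {poly 'F_p}).
Variables (f_irr : irreducible_poly f) (f_deg : size f = s.+1).
Local Notation K := (GF f_irr f_deg).
Local Notation F := (local_field f_irr f_deg).

Lemma GF_eq (u v : K) : (forall l, GF_coord u l = GF_coord v l) -> u = v.
Proof. by move=> uv; apply/rowP => l; exact: uv. Qed.

Lemma GF_mulrp (u : K) : u *+ p = 0.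
Proof.
apply/rowP => l; rewrite -[LHS]/((u *+ p : 'rV['F_p]_s) 0 l) mulmxnE mxE.
by rewrite mulrn_pchar// pchar_Fp.
Qed.

Definition GF_basis (l : 'I_s) : K := delta_mx 0 l.

Lemma GF_coord_basis l l' : GF_coord (GF_basis l) l' = (l' == l)%:R.
Proof. by rewrite /GF_coord mxE eqxx. Qed.

Lemma GF_basis_sum (u : K) : u = \sum_(l < s) GF_basis l *+ GF_coord u l.
Proof.
rewrite -[LHS]/(u : 'rV['F_p]_s) [LHS]row_sum_delta; apply: eq_bigr => l _.
by rewrite -[X in X *: _]natr_Zp scaler_nat.
Qed.

Definition lf_single_seq (k : int) (u : K) : int -> K :=
  fun j => if j == k then u else 0.

Lemma lf_single_proof k u :
  lf_single_seq k u \in @finite_negative_support _ _ _ f_irr f_deg.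
Proof.
apply/asboolP; apply: sub_finite_set (finite_set1 k) => j /= [_].
by rewrite /lf_single_seq; case: (eqVneq j k) => // _ /eqP.
Qed.

Definition lf_single k u : F := LocalField (lf_single_proof k u).

Lemma lf_singleE k u j : lf_single k u j = if j == k then u else 0.
Proof. by []. Qed.

Lemma lf_eq (x y : F) : (forall j, x j = y j) -> x = y.
Proof. by move=> xy; apply/val_inj/funext. Qed.

Lemma lfMn (x : F) n j : (x *+ n) j = x j *+ n.
Proof. by elim: n => // n IHn; rewrite !mulrS lfD IHn. Qed.

Lemma lf_mulrp (x : F) : x *+ p = 0.
Proof. by apply: lf_eq => j; rewrite lfMn GF_mulrp. Qed.

Fact lf_single_zmod_morphism k : zmod_morphism (lf_single k).
Proof.
move=> u v; apply: lf_eq => j; rewrite lfB !lf_singleE.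
by case: ifP => // _; rewrite subr0.
Qed.

HB.instance Definition _ k :=
  GRing.isZmodMorphism.Build K F (lf_single k) (lf_single_zmod_morphism k).

Lemma lf_subgroupMn n (x : F) j : lf_subgroup n x -> lf_subgroup n (x *+ j).
Proof. by move=> xn i /xn; rewrite lfMn => ->; rewrite mul0rn. Qed.

Lemma lf_in_subgroup (x : F) : exists n : int, lf_subgroup n x.
Proof.
have /asboolP/finite_int_bounded[n xn] := valP x.
exists (- n%:Z - 1) => j jn; apply/eqP; apply: contraT => xj.
have j0 : j < 0 by apply: lt_le_trans jn _; rewrite -opprD oppr_le0.
have := xn j (conj j0 xj); rewrite -lez_nat abszE ltr0_norm// => jle.
suff: n%:Z + 1 < n%:Z by rewrite gtrDl ltr10.
by apply: lt_le_trans jle; rewrite ltrNr opprD.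
Qed.

End LocalFieldGenerators.

(** * Coordinates of characters *)

Section Characters.
Variables (R : realType) (p s : nat) (p_prime : prime p) (f : {poly 'F_p}).
Variables (f_irr : irreducible_poly f) (f_deg : size f = s.+1).
Local Notation K := (GF f_irr f_deg).
Local Notation F := (local_field f_irr f_deg).
Local Notation X := (character R f_irr f_deg).
Local Notation D := (dual_seq f_irr f_deg).
Local Notation zeta := (expi (2 * pi / p%:R : R)).
Local Notation char_of := (char_of R p_prime).
Implicit Types (chi psi : X) (x y : F) (a : D).

Let zetaP : p.-primitive_root zeta := expi_primitive R p_prime.

Lemma char0 chi : chi 0 = 1.
Proof.
have nz : chi 0 != 0 by rewrite -normr_eq0 char_unit oner_eq0.
by apply: (mulfI nz); rewrite -charD addr0 mulr1.
Qed.

Lemma charMn chi x n : chi (x *+ n) = chi x ^+ n.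
Proof.
by elim: n => [|n IHn]; rewrite ?char0 // mulrS charD IHn exprS.
Qed.

Lemma char_expp chi x : chi x ^+ p = 1.
Proof. by rewrite -charMn lf_mulrp// char0. Qed.

Lemma char_sum chi (I : finType) (x : I -> F) :
  chi (\sum_i x i) = \prod_i chi (x i).
Proof. by apply: (big_morph chi (charD chi) (char0 chi)). Qed.

(** Near 0 the character takes values at distance less than 1 from 1, and the
    neighbourhoods F_n of 0 are subgroups: all powers of these values are again
    close to 1. *)
Lemma char_trivial chi :
  exists n : int, forall x, lf_subgroup n x -> chi x = 1.
Proof.
have chi_cont : continuous (chi : F -> R[i]^o) by exact: char_continuous.
have [n _ chi_n] := chi_cont 0 _ (nbhsx_ballx (chi 0 : R[i]^o) 1 ltr01).
exists n => x xn; apply: (root_of_unity_near1 (prime_gt0 p_prime)).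
  exact: char_expp.
move=> j; have := chi_n (x *+ j); rewrite /ball /= char0 charMn distrC; apply.
by rewrite subr0; exact: lf_subgroupMn.
Qed.

(** These are the elements e_{k,l}. *)
Definition lf_unit k l : F := lf_single k (GF_basis f_irr f_deg l).

Lemma lf_unitE k l j :
  lf_unit k l j = if j == k then GF_basis f_irr f_deg l else 0.
Proof. exact: lf_singleE. Qed.

(** Both characters are trivial on F_N for N large, and they agree on the
    elements with a single nonzero term, which are sums of the e_{k,l}.
    Splitting off the lowest term of x in F_(N-d-1) leaves an element of F_(N-d),
    so agreement spreads by induction on d; every x lies in some F_(N-d). *)
Lemma char_eq_units chi psi :
  (forall k l, chi (lf_unit k l) = psi (lf_unit k l)) -> chi = psi.
Proof.
move=> eq_units.
have eq_single k u : chi (lf_single k u) = psi (lf_single k u).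
  rewrite (GF_basis_sum u) raddf_sum !char_sum; apply: eq_bigr => l _.
  by rewrite raddfMn !charMn eq_units.
have [m chi_m] := char_trivial chi; have [n psi_n] := char_trivial psi.
pose N := Order.max m n.
have eq_sub d x : lf_subgroup (N - d%:Z) x -> chi x = psi x.
  elim: d x => [|d IHd] x xN.
    by rewrite chi_m ?psi_n// => j jlt; apply: xN;
      rewrite subr0 lt_max jlt ?orbT.
  set k := N - d.+1%:Z in xN.
  rewrite -(subrK (lf_single k (x k)) x) charD [RHS]charD eq_single.
  rewrite IHd// => j jlt; rewrite lfB lf_singleE.
  have [->|jk] := eqVneq; first exact: subrr.
  rewrite subr0 xN// lt_neqAle jk /= -ltzD1 /k.
  by rewrite -addn1 PoszD opprD addrA subrK.
apply: char_eq => x; have [i xi] := lf_in_subgroup x.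
(* The absolute value also covers i > N, where x already lies in F_N. *)
apply: (eq_sub `|N - i|%N) => j jlt; apply: xi; apply: lt_le_trans jlt _.
by rewrite lerBlDr -lerBlDl abszE ler_norm.
Qed.

Lemma char_of_unit a k l : char_of a (lf_unit k l) = zeta ^+ GF_coord (a k) l.
Proof.
have supp : ([set j | rademacher R j (a j) (lf_unit k l) != 1] `<=` [set k])%classic.
  move=> j /=; apply: contra_neqP => /eqP jk.
  by rewrite rademacher_at0 // lf_unitE (negPf jk).
rewrite -[LHS]/(rademacher_prod R a _) (rademacher_prodE supp) fsbig_set1.
rewrite /rademacher lf_unitE eqxx (bigD1 l) //= big1 => [|i il].
  by rewrite mulr1 GF_coord_basis eqxx muln1 expiM.
by rewrite GF_coord_basis (negPf il) muln0 mulr0 expi0.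
Qed.

(** An element of the prime field is read as its representative in
    {0, ..., p-1}, on which the powers of a primitive p-th root of unity are
    distinct. *)
Lemma Fp_exp_inj (u v : 'F_p) : zeta ^+ u = zeta ^+ v -> u = v.
Proof.
move=> /eqP; rewrite (eq_prim_root_expr zetaP) => /eqP uv.
have ltp (w : 'F_p) : (w < p)%N by rewrite -[X in (_ < X)%N](Fp_cast p_prime).
by apply: val_inj; rewrite /= !modn_small in uv.
Qed.

(** The sequence of exponents is read off from the values at the e_{k,l}.  It
    defines an infinite product because the character is trivial on some F_n,
    so that the exponents at the places k >= n are 0. *)
Lemma char_of_surj chi : exists a, chi = char_of a.
Proof.
have root_unit k l : chi (lf_unit k l) ^+ p = 1 by exact: char_expp.
pose a k : K := \row_l (sval (prim_rootP zetaP (root_unit k l)) : nat)%:R.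
have aE k l : chi (lf_unit k l) = zeta ^+ GF_coord (a k) l.
  rewrite /GF_coord mxE val_Fp_nat// (prim_expr_mod zetaP).
  by case: (prim_rootP _ _).
have fin_a : a \in @finite_positive_support _ _ _ f_irr f_deg.
  have [n chi_n] := char_trivial chi.
  apply/asboolP; apply: (@finite_int_below _ n) => k /= [k0].
  rewrite (ltW k0) /= ltNge; apply: contra_neqN => nk.
  apply: GF_eq => l; apply: Fp_exp_inj; rewrite -aE GF_coord0 expr0.
  apply: chi_n => j jn; rewrite lf_unitE lt_eqF//; exact: lt_le_trans nk.
exists (DualSeq fin_a); apply: char_eq_units => k l.
by rewrite aE char_of_unit.
Qed.

Local Notation coords := (char_coords p_prime).

(** Existence gives meaning to the coordinates, which were defined by choice
    with a default value. *)
Lemma char_coordsK chi : char_of (coords chi) = chi.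
Proof. by rewrite -(xgetPex (ds_zero f_irr f_deg) (char_of_surj chi)). Qed.

(** Coordinates are thus logarithms of values, to the base zeta; this turns the
    product of characters into the sum of coordinates. *)
Lemma char_unitE chi k l : chi (lf_unit k l) = zeta ^+ GF_coord (coords chi k) l.
Proof. by rewrite -{1}(char_coordsK chi) char_of_unit. Qed.

Lemma char_coords_of a k : coords (char_of a) k = a k.
Proof.
by apply: GF_eq => l; apply: Fp_exp_inj; rewrite -char_unitE char_of_unit.
Qed.

Lemma char_coords_inj chi psi :
  (forall k, coords chi k = coords psi k) -> chi = psi.
Proof. by move=> cc; apply: char_eq_units => k l; rewrite !char_unitE cc. Qed.

Lemma char_coords_mul chi psi k :
  coords (char_mul chi psi) k = coords chi k + coords psi k.
Proof.
apply: GF_eq => l; apply: Fp_exp_inj; rewrite -char_unitE /= !char_unitE.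
rewrite GF_coordD -exprD -(prim_expr_mod zetaP); congr (_ ^+ _).
by apply: congr1; apply: esym; apply: Fp_cast.
Qed.

Lemma char_coords_pow chi b k :
  coords (char_pow p_prime chi b) k = coords chi k * b.
Proof. exact: char_coords_of. Qed.

End Characters.

Theorem theorem4p1 (R : realType) (p s : nat) (p_prime : prime p)
    (f : {poly 'F_p}) (f_irr : irreducible_poly f) (f_deg : size f = s.+1) :
  @is_vector_space (GF f_irr f_deg) (character R f_irr f_deg)
    (fun chi psi => char_mul chi psi)
    (fun b chi => char_pow p_prime chi b).
Proof.
have mulE := char_coords_mul p_prime; have powE := char_coords_pow p_prime.
apply: (@is_vector_space_axioms _ _ _
  (char_of R p_prime (ds_zero f_irr f_deg))
  (fun chi => char_pow p_prime chi (-1))) => [u v w|u v|u|u|a b u|u|b u v|u a b];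
  apply: (char_coords_inj (p_prime := p_prime)) => k;
  rewrite ?(mulE, powE, char_coords_of).
- exact: addrA.
- exact: addrC.
- exact: add0r.
- by rewrite mulrN1 addNr.
- by rewrite -mulrA [b * a]mulrC.
- exact: mulr1.
- by rewrite mulrDl.
- by rewrite mulrDr.
Qed.
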